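(* Let $n,m\ge1$, let $D_1,\dots,D_n\in\mathbf R^{m\times m}$, and let $D^{[i]}$, $d_i''$, $E_i$ be as defined in the context. Let $i$ be an integer with $1\le i\le n$. For each $j=1,2,\dots,i$, let $f_j$ be an integer with $0\le f_j\le d_j''$, and let $F_j\in\mathbf R^{f_j\times m}$ be any matrix of rank $f_j$ satisfying $$\mathrm{im}(F_j^{\mathrm T})\setminus\{0\}\subseteq\mathrm{im}(E_j^{\mathrm T})\setminus\mathrm{im}(E_{j-1}^{\mathrm T}),$$ where $\mathrm{im}(E_0^{\mathrm T})=\{0\}$. Then: 1. There exists a matrix $Q\in\mathbf R^{f\times mi}$, with $f=\sum_{j=1}^if_j$, such that $$QD^{[i]}=\begin{bmatrix}F_1&*&\cdots&*\\ &F_2&\cdots&*\\ &&\ddots&\vdots\\ &&&F_i\end{bmatrix},$$ where the row blocks have heights $f_1,\dots,f_i$, the column blocks have width $m$, the blocks below the $F_j$ are zero, and the blocks $*$ are unspecified. 2. If $f_j=d_j''$ for $j=1,2,\dots,i$, then $\mathrm{im}\begin{bmatrix}F_1^{\mathrm T}&F_2^{\mathrm T}&\cdots&F_i^{\mathrm T}\end{bmatrix}=\mathrm{im}(E_i^{\mathrm T})$. 3. For $Q$ as in item 1, partitioned as $Q=\begin{bmatrix}*&Q_1\end{bmatrix}$ with $Q_1\in\mathbf R^{f\times m}$ (the last $m$ columns), the submatrix $Q_1$ has full row rank.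
   Context: For $i=1,\dots,n$, $D^{[i]}\in\mathbf R^{mi\times mi}$ is the block skew lower-triangular Hankel matrix whose $(j,k)$ block ($m\times m$, $1\le j,k\le i$) is $0$ if $j+k\le i$ and $D_{j+k-i}$ if $j+k\ge i+1$ (so the last block row is $[D_1\ D_2\ \cdots\ D_i]$). Put $d_i=\mathrm{rank}(D^{[i]})$; $d_1'=d_1$ and $d_i'=d_i-d_{i-1}$ for $i\ge2$; $d_1''=d_1'$ and $d_i''=d_i'-d_{i-1}'$ for $i\ge2$. The reduced row-echelon form of $D^{[n]}$, with columns divided into $n$ blocks of width $m$, is partitioned as $$\mathrm{rref}(D^{[n]})=\begin{bmatrix}E_1&*&\cdots&*\\ &E_2&\cdots&*\\ &&\ddots&\vdots\\ &&&E_n\\ 0&0&\cdots&0\end{bmatrix},$$ where each $E_i$ has $m$ columns and full row rank; that is, the $i$-th row block consists of the nonzero rows whose pivot lies in the $i$-th column block, and $E_i$ is the $i$-th column block of those rows. Matrices with zero rows are allowed (empty matrices), and have row space $\{0\}$. $\mathrm{im}(X^{\mathrm T})$ denotes the row space of $X$. It is known that $E_i$ has $d_i'$ rows, $d_i''\ge0$, and $\mathrm{im}(E_{i-1}^{\mathrm T})\subseteq\mathrm{im}(E_i^{\mathrm T})$. *)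

(* Defs.v *)
From HB Require Import structures.
From mathcomp Require Import all_boot all_order all_algebra.
From mathcomp Require Import reals.

Set Implicit Arguments.
Unset Strict Implicit.
Unset Printing Implicit Defensive.

Import Order.TTheory GRing.Theory Num.Theory.
Local Open Scope ring_scope.

Definition pivot (F : fieldType) p q (M : 'M[F]_(p, q)) (i : 'I_p) (j : 'I_q) : bool :=
  (M i j != 0) && [forall k : 'I_q, (k < j)%N ==> (M i k == 0)].

(* The last clause says both that pivots move strictly to the right and that
   zero rows are at the bottom. *)
Definition is_rref (F : fieldType) p q (M : 'M[F]_(p, q)) : bool :=
  [forall i, forall j, pivot M i j ==>
    [&& M i j == 1,
        [forall k : 'I_p, (k != i) ==> (M k j == 0)] &
        [forall k : 'I_p, (k < i)%N ==>
           [exists l : 'I_q, (l < j)%N && pivot M k l]]]].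

Lemma pivot_exists (F : fieldType) p q (M : 'M[F]_(p, q)) i j :
  M i j != 0 -> exists l, pivot M i l.
Proof.
move=> nz; case: (@arg_minnP _ j (fun l => M i l != 0) (@nat_of_ord q) nz) => l nzl lmin.
exists l; rewrite /pivot nzl /=; apply/forallP => k; apply/implyP => lt_kl.
by apply: contraLR lt_kl => /lmin; rewrite -leqNgt.
Qed.

Lemma rref_exists (F : fieldType) p q (A : 'M[F]_(p, q)) :
  exists P : 'M[F]_p, (P \in unitmx) && is_rref (P *m A).
Proof.
elim: q A => [|q IHq] A.
  exists 1%:M; rewrite unitmx1 /=.
  by apply/forallP => i; apply/forallP => -[].
pose w := widen_ord (leqnSn q).
have [P /andP[Pu PA]] := IHq (colsub w A).
set B := P *m A.
have wlt (j : 'I_q.+1) : j != ord_max -> exists j', j = w j'.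
  rewrite -val_eqE /= => nj.
  have lt_jq : (j < q)%N by rewrite ltn_neqAle nj -ltnS ltn_ord.
  by exists (Ordinal lt_jq); apply: val_inj.
have BE : P *m colsub w A = colsub w B.
  by apply/matrixP => i j; rewrite !mxE; apply: eq_bigr => k _; rewrite !mxE.
rewrite BE in PA.
have BA : B = P *m A by [].
clearbody B.
pose Z := [set i | [forall j : 'I_q, B i (w j) == 0]].
have notZ i : i \notin Z -> exists l, pivot (colsub w B) i l.
  rewrite inE negb_forall => /existsP[j nz].
  by apply: (@pivot_exists _ _ _ _ _ j); rewrite mxE.
have pivw (C : 'M_(p, q.+1)) i j : (forall k l, C k (w l) = B k (w l)) ->
    pivot C i (w j) = pivot (colsub w B) i j.
  move=> CB; rewrite /pivot CB mxE; congr (_ && _).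
  apply/forallP/forallP => H k.
    by have := H (w k); rewrite CB mxE.
  apply/implyP => lt_kj; have [|k' ek] := wlt k.
    rewrite -val_eqE /= neq_ltn; apply/orP; left.
    exact: ltn_trans lt_kj (ltn_ord j).
  by have := H k'; rewrite mxE ek CB => /implyP; apply; move: lt_kj; rewrite ek.
have rr (C : 'M_(p, q.+1)) : (forall k l, C k (w l) = B k (w l)) ->
    (forall i, pivot C i ord_max -> [/\ C i ord_max = 1,
        forall k, k != i -> C k ord_max = 0 & forall k : 'I_p, (k < i)%N -> k \notin Z]) ->
    is_rref C.
  move=> CB Cm; apply/forallP => i; apply/forallP => j; apply/implyP => pv.
  have [ej|/wlt[j' ej]] := eqVneq j ord_max.
    rewrite ej in pv *; have [-> C0 CZ] := Cm i pv.
    rewrite eqxx /=; apply/andP; split.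
      by apply/forallP => k; apply/implyP => /C0 ->.
    apply/forallP => k; apply/implyP => /CZ/notZ[l pl].
    by apply/existsP; exists (w l); rewrite pivw // pl andbT /= ltn_ord.
  rewrite {}ej in pv *; rewrite pivw // in pv.
  move: PA; rewrite /is_rref => /forallP/(_ i)/forallP/(_ j')/implyP/(_ pv)/and3P[h1 h2 h3].
  apply/and3P; split; first by move: h1; rewrite mxE CB.
    by apply/forallP => k; have /forallP/(_ k) := h2; rewrite mxE CB.
  apply/forallP => k; apply/implyP => lt_ki.
  have /forallP/(_ k)/implyP/(_ lt_ki)/existsP[l /andP[lt_lj pl]] := h3.
  by apply/existsP; exists (w l); rewrite pivw // pl andbT.
case: (pickP [pred i | (i \in Z) && (B i ord_max != 0)]) => [i0 /= /andP[Zi0 nz]|noZ]; last first.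
  exists P; rewrite Pu -BA /=; apply: rr => // i /andP[nz] /forallP H.
  have := noZ i; rewrite /= nz andbT inE => /negP[].
  by apply/forallP => j; have /implyP := H (w j); apply; rewrite /= ltn_ord.
case: (@arg_minnP _ i0 (mem Z) (@nat_of_ord p) Zi0) => r Zr rmin.
pose C : 'M[F]_(p, q.+1) :=
  \matrix_(i, j) if j == ord_max then (i == r)%:R else B i j.
have wmax l : (w l == ord_max) = false.
  by apply/negbTE; rewrite -val_eqE /= neq_ltn ltn_ord.
have CB k l : C k (w l) = B k (w l) by rewrite mxE wmax.
pose e : 'rV[F]_q.+1 := delta_mx 0 ord_max.
have rowZ i (X : 'M[F]_(p, q.+1)) : i \in Z -> (forall l, X i (w l) = B i (w l)) ->
    row i X = X i ord_max *: e.
  rewrite inE => /forallP Zi XB; apply/rowP => j; rewrite !mxE /=.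
  have [->|/wlt[j' ->]] := eqVneq j ord_max; first by rewrite mulr1.
  by rewrite XB (eqP (Zi j')) mulr0.
have eC : row r C = e by rewrite rowZ // mxE !eqxx scale1r.
have eB : row i0 B = B i0 ord_max *: e by rewrite rowZ.
have rowBC i : row i B = row i C + (B i ord_max - (i == r)%:R) *: e.
  apply/rowP => j; rewrite !mxE /=.
  have [->|/wlt[j' ->]] := eqVneq j ord_max; first by rewrite mulr1 addrC subrK.
  by rewrite mulr0 addr0.
have eqCB : (C == B)%MS.
  have e_C : (e <= C)%MS by rewrite -eC row_sub.
  have e_B : (e <= B)%MS by rewrite -(eqmx_scale _ nz) -eB row_sub.
  apply/andP; split; apply/row_subP => i.
    have -> : row i C = row i B - (B i ord_max - (i == r)%:R) *: e by rewrite rowBC addrK.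
    by rewrite addmx_sub ?row_sub // eqmx_opp scalemx_sub.
  by rewrite rowBC addmx_sub ?row_sub // scalemx_sub.
have /eqmxMunitP[T Tu CT] := eqCB.
exists (T *m P); rewrite unitmx_mul Tu Pu -mulmxA -BA -CT /=.
apply: rr => // i /andP[nzi _].
have ei : i = r by apply/eqP; move: nzi; rewrite mxE eqxx; case: (i == r); rewrite ?eqxx.
rewrite ei; split; first by rewrite mxE !eqxx.
  by move=> k /negbTE nk; rewrite mxE eqxx nk.
by move=> k lt_kr; apply: contraL lt_kr => /rmin; rewrite -leqNgt.
Qed.

(* The reduced row-echelon form of a matrix being unique, it does not depend
   on the invertible P that is chosen. *)
Definition rref (F : fieldType) p q (A : 'M[F]_(p, q)) : 'M[F]_(p, q) :=
  xchoose (rref_exists A) *m A.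

Lemma rrefP (F : fieldType) p q (A : 'M[F]_(p, q)) :
  is_rref (rref A) /\ exists2 P : 'M[F]_p, P \in unitmx & rref A = P *m A.
Proof.
have /andP[Pu PA] := xchooseP (rref_exists A).
by split=> //; exists (xchoose (rref_exists A)).
Qed.

(* D^[i]; the family D_1, D_2, ... is indexed from 1, whereas ordinals, hence
   block positions, start at 0. *)
Definition hankel (F : fieldType) m (D : nat -> 'M[F]_m) (i : nat)
    : 'M[F]_(\sum_(j < i) m, \sum_(k < i) m) :=
  \mxblock_(j < i, k < i)
    (if (j.+1 + k.+1 <= i)%N then 0 else D (j.+1 + k.+1 - i)%N).

Definition d (F : fieldType) m (D : nat -> 'M[F]_m) (i : nat) : int :=
  (\rank (hankel D i))%:Z.

Definition d' (F : fieldType) m (D : nat -> 'M[F]_m) (i : nat) : int :=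
  if (i <= 1)%N then d D 1 else d D i - d D i.-1.

Definition d'' (F : fieldType) m (D : nat -> 'M[F]_m) (i : nat) : int :=
  if (i <= 1)%N then d' D 1 else d' D i - d' D i.-1.

(* The rows whose pivot lies in the k-th column block, k counted from 1
   (tagnat.sig1 c is the block of column c, counted from 0); no row for k = 0. *)
Definition pivot_rows (F : fieldType) p n m (M : 'M[F]_(p, \sum_(k < n) m))
    (k : nat) : {set 'I_p} :=
  [set r | [exists c, pivot M r c && ((tagnat.sig1 c).+1 == k)]].

(* The k-th column block, 1 <= k <= n; the values for other k are irrelevant. *)
Definition column_block (F : fieldType) p n m (M : 'M[F]_(p, \sum_(k < n) m))
    (k : nat) : 'M[F]_(p, m) :=
  if insub k.-1 is Some b then submxrow M (b : 'I_n) else 0.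

(* E n D k is the k-th diagonal block of rref (D^[n]), 1 <= k <= n, and
   E n D 0 has no row. *)
Definition E (F : fieldType) m (n : nat) (D : nat -> 'M[F]_m) (k : nat)
    : 'M[F]_(#|pivot_rows (rref (hankel D n)) k|, m) :=
  rowsub enum_val (column_block (rref (hankel D n)) k).

Definition block_upper_with_diag (F : fieldType) i m (f : 'I_i -> nat)
    (B : forall j : 'I_i, 'M[F]_(f j, m))
    (X : 'M[F]_(\sum_j f j, \sum_(k < i) m)) : Prop :=
  (forall j, submxblock X j j = B j) /\
  (forall j k : 'I_i, (k < j)%N -> submxblock X j k = 0).

(* Main.v *)
(* Let V_k be the space of the v such that the row space of D^[n] has an
   element whose k-th block is v and whose previous blocks are zero. The
   pivot rows of the reduced row-echelon form show that V_k is the row space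
   of E_k. By the Hankel structure x D^[n] is a discrete convolution of the
   blocks of x, read from right to left, with D_1, D_2, ...; hence V_k does
   not depend on n, and dim V_k = d_k - d_{k-1}. Delaying x by one block
   shifts the convolution, so V_{k-1} is contained in V_k, and F_k, when of
   maximal size, is a complement of V_{k-1} in V_k. Conversely, if the last
   block of x vanishes, x can be advanced by one block: if z Q_1 = 0 and z_j
   is the first nonzero block of z, then z_j F_j, the leading block of z Q
   D^[i], is in V_{j-1}, a contradiction. *)
Require Import Defs.
From mathcomp Require Import all_boot all_order all_algebra.
From mathcomp Require Import reals.
From mathcomp Require Import zify.
Import Order.TTheory GRing.Theory Num.Theory.
Local Open Scope ring_scope.
Set Implicit Arguments.
Unset Strict Implicit.

(** * Leading blocks of row-space elements of a block matrix *)

Definition init_blocks (F : fieldType) p n m (H : 'M[F]_(p, \sum_(k < n) m))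
    (b : 'I_n) : 'M[F]_(p, \sum_(k < b) m) :=
  \mxrow_(k < b) submxrow H (widen_ord (ltnW (ltn_ord b)) k).

(** For a Hankel matrix this is the space $V_{b+1}$ of the overview, since [b] is counted from 0. *)
Definition lead_space (F : fieldType) p n m (H : 'M[F]_(p, \sum_(k < n) m))
    (b : 'I_n) : 'M[F]_(p, m) := kermx (init_blocks H b) *m submxrow H b.

Lemma lead_spaceP (F : fieldType) p n m (H : 'M[F]_(p, \sum_(k < n) m))
    (b : 'I_n) q (V : 'M[F]_(q, m)) :
  reflect (exists2 U : 'M[F]_(q, p),
             forall k : 'I_n, (k < b)%N -> submxrow (U *m H) k = 0 &
             submxrow (U *m H) b = V)
          (V <= lead_space H b)%MS.
Proof.
apply: (iffP submxP) => [[X ->]|[U U0 UV]].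
  exists (X *m kermx (init_blocks H b)) => [k kb|]; last first.
    by rewrite -mul_submxrow -mulmxA.
  have: X *m kermx (init_blocks H b) *m init_blocks H b = 0.
    by rewrite -mulmxA mulmx_ker mulmx0.
  rewrite mul_mxrow -[RHS](@mxrow0 F _ (fun=> m)) => /eq_mxrowP/(_ (Ordinal kb)).
  by rewrite mul_submxrow => <-; congr submxrow; apply: val_inj.
have /submxP[X eX] : (U <= kermx (init_blocks H b))%MS.
  apply/sub_kermxP; rewrite mul_mxrow -[RHS](@mxrow0 F _ (fun=> m)).
  by apply/eq_mxrowP => k; rewrite mul_submxrow U0 //=.
by exists X; rewrite -UV -mul_submxrow eX -mulmxA.
Qed.

(** Rank-nullity for the last block restricted to [kermx A]: what this restriction kills is exactly
    [kermx H]. *)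
Lemma rank_lead_space (F : fieldType) p n m (H : 'M[F]_(p, \sum_(k < n.+1) m)) :
  (\rank (lead_space H ord_max) + \rank (init_blocks H ord_max))%N = \rank H.
Proof.
set A := init_blocks H ord_max.
have capE : (kermx A :&: kermx (submxrow H ord_max) :=: kermx H)%MS.
  apply/eqmxP/andP; split; apply/rV_subP => v; rewrite sub_capmx.
    case/andP => /sub_kermxP vA /sub_kermxP vB; apply/sub_kermxP/mxrowP => k.
    rewrite submxrow0; have [kn|nk] := ltnP k n; last first.
      have -> : k = ord_max by apply/val_inj/eqP; rewrite eqn_leq nk -ltnS ltn_ord.
      by rewrite -mul_submxrow.
    move: vA; rewrite mul_mxrow -[RHS](@mxrow0 F _ (fun=> m)).
    move=> /eq_mxrowP/(_ (Ordinal kn)); rewrite mul_submxrow => <-.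
    by congr submxrow; apply: val_inj.
  move/sub_kermxP => vH; apply/andP; split; apply/sub_kermxP; last first.
    by rewrite mul_submxrow vH submxrow0.
  rewrite mul_mxrow -[RHS](@mxrow0 F _ (fun=> m)); apply/eq_mxrowP => k.
  by rewrite mul_submxrow vH submxrow0.
have := mxrank_mul_ker (kermx A) (submxrow H ord_max).
rewrite capE !mxrank_ker -/(lead_space H ord_max).
have := rank_leq_row H; have := rank_leq_row A; lia.
Qed.

(** * Block Hankel matrices as convolutions *)

(* With blocks of Q numbered from the right, Q *m hankel D n becomes a
   convolution that no longer depends on n. *)
Definition conv (F : fieldType) p m (D : nat -> 'M[F]_m)
    (y : nat -> 'M[F]_(p, m)) (k : nat) : 'M[F]_(p, m) :=
  \sum_(a < k.+1) y a *m D (k.+1 - a)%N.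

Lemma mul_hankel (F : fieldType) p m (D : nat -> 'M[F]_m)
    (y : nat -> 'M[F]_(p, m)) n (k : 'I_n) :
  submxrow (\mxrow_(j < n) y (n - j.+1)%N *m hankel D n) k = conv D y k.
Proof.
rewrite /hankel mxblockEh -mul_submxrow mxrowK mul_mxrow_mxcol /conv.
(* With [a] counting row blocks from the bottom, the zero blocks are those with [k < a], and the
   others have subscript [k.+1 - a]. *)
rewrite (reindex_inj rev_ord_inj) /=.
rewrite (big_ord_widen n (fun a => y a *m D (k.+1 - a)%N)) ?ltn_ord //.
rewrite [RHS]big_mkcond; apply: eq_bigr => a _ /=.
have an := ltn_ord a.
rewrite subnSK // (subKn (ltnW an)).
case: ifP; case: ifP; rewrite ?mulmx0 // => h1 h2.
- by exfalso; move: h1 h2 an; clear; lia.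
- by congr (_ *m D _); move: an h1 h2; clear; lia.
- by exfalso; move: h1 h2 an; clear; lia.
Qed.

Lemma rev_blocks (F : fieldType) p m n (Q : 'M[F]_(p, \sum_(j < n) m)) :
  exists y : nat -> 'M[F]_(p, m), Q = \mxrow_(j < n) y (n - j.+1)%N.
Proof.
(* Only the values at [a < n] matter; the others are arbitrary. *)
exists (fun a => oapp (submxrow Q) 0 (insub (n - a.+1)%N)).
rewrite -[LHS]submxrowK; apply: eq_mxrow => j.
rewrite subnSK ?ltn_ord // (subKn (ltnW (ltn_ord j))).
by rewrite valK.
Qed.

(** The right-hand side does not mention [n]; this makes the leading spaces independent of the size
    of the Hankel matrix. *)
Lemma lead_space_hankelP (F : fieldType) m (D : nat -> 'M[F]_m) n (b : 'I_n)
    q (V : 'M[F]_(q, m)) :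
  (V <= lead_space (hankel D n) b)%MS <->
  (exists2 y : nat -> 'M[F]_(q, m),
     forall k, (k < b)%N -> conv D y k = 0 & conv D y b = V).
Proof.
split=> [/lead_spaceP[Q Q0 <-]|[y y0 <-]].
  have [y eQ] := rev_blocks Q; subst Q; exists y => [k kb|]; last by rewrite mul_hankel.
  by rewrite -(mul_hankel D y (Ordinal (ltn_trans kb (ltn_ord b)))) Q0.
apply/lead_spaceP; exists (\mxrow_(j < n) y (n - j.+1)%N) => [k kb|].
  by rewrite mul_hankel y0.
by rewrite mul_hankel.
Qed.

Lemma lead_space_hankel (F : fieldType) m (D : nat -> 'M[F]_m) n n' (b : 'I_n)
    (b' : 'I_n') :
  b = b' :> nat ->
  (lead_space (hankel D n) b :=: lead_space (hankel D n') b')%MS.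
Proof.
move=> eb; apply/eqmxP/andP; split.
  by apply/lead_space_hankelP; rewrite -eb; apply/lead_space_hankelP.
by apply/lead_space_hankelP; rewrite eb; apply/lead_space_hankelP.
Qed.

(** Both matrices turn a sequence [y] into the first [b] terms of the same convolution, and every
    row vector comes from such a sequence. *)
Lemma init_blocks_hankel (F : fieldType) m (D : nat -> 'M[F]_m) n (b : 'I_n) :
  (init_blocks (hankel D n) b :=: hankel D b)%MS.
Proof.
have blockE q (y : nat -> 'M[F]_(q, m)) :
    \mxrow_(j < n) y (n - j.+1)%N *m init_blocks (hankel D n) b =
    \mxrow_(j < b) y (b - j.+1)%N *m hankel D b.
  apply/mxrowP => k; rewrite -mul_submxrow mxrowK mul_submxrow mul_hankel.
  by rewrite mul_hankel.
apply/eqmxP/andP; split; apply/rV_subP => v /submxP[Q ->];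
  have [y ->] := rev_blocks Q.
  by rewrite blockE submxMl.
by rewrite -blockE submxMl.
Qed.

Lemma rank_lead_space_hankel (F : fieldType) m (D : nat -> 'M[F]_m) n (b : 'I_n) :
  (\rank (lead_space (hankel D n) b) + \rank (hankel D b))%N =
  \rank (hankel D b.+1).
Proof.
rewrite (@lead_space_hankel _ _ D n b.+1 b ord_max) //.
by rewrite -rank_lead_space init_blocks_hankel.
Qed.

Lemma lead_space_hankelS (F : fieldType) m (D : nat -> 'M[F]_m) n (b c : 'I_n) :
  c = b.+1 :> nat ->
  (lead_space (hankel D n) b <= lead_space (hankel D n) c)%MS.
Proof.
move=> cb; have /lead_space_hankelP[y y0 yb] := submx_refl (lead_space (hankel D n) b).
(* Delaying [y] by one block delays its convolution by one block. *)
pose z a := if a is a'.+1 then y a' else 0.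
have zS k : conv D z k.+1 = conv D y k.
  by rewrite /conv big_ord_recl mul0mx add0r.
apply/lead_space_hankelP; exists z => [[|k] kc|]; last by rewrite cb zS.
  by rewrite /conv big_ord1 mul0mx.
by rewrite zS y0 // -ltnS -cb.
Qed.

(** * Pivot rows of the reduced row-echelon form *)

Lemma leq_sig1 n m (c c' : 'I_(\sum_(k < n) m)) :
  (c <= c')%N -> (tagnat.sig1 c <= tagnat.sig1 c')%N.
Proof. exact: tagnat.le_sig1. Qed.

(** A combination that vanishes before block [b] cannot involve rows with a pivot there, and rows
    with a later pivot are zero in block [b]. *)
Lemma lead_space_rref (F : fieldType) p n m (A : 'M[F]_(p, \sum_(k < n) m))
    (b : 'I_n) :
  (lead_space A b :=:
   rowsub (enum_val (A := mem (pivot_rows (rref A) b.+1))) (submxrow (rref A) b))%MS.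
Proof.
have [rr [P Pu MP]] := rrefP A; move: (rref A) rr MP => M rr MP.
have pivotsE r c : pivot M r c -> M r c = 1 /\ forall k, k != r -> M k c = 0.
  move=> pv; move/forallP: rr => /(_ r)/forallP/(_ c)/implyP/(_ pv)/and3P[/eqP-> /forallP H _].
  by split=> // k kr; apply/eqP; have /implyP := H k; apply.
have before r (c c' : 'I_(\sum_(k < n) m)) : pivot M r c -> (c' < c)%N -> M r c' = 0.
  by case/andP => _ /forallP/(_ c')/implyP H /H/eqP.
apply/eqmxP/andP; split.
  apply/rV_subP => v /lead_spaceP[u u0 uv].
  have [y yM] : exists y, u *m A = y *m M.
    by exists (u *m invmx P); rewrite MP mulmxA mulmxKV.
  (* A pivot column is a unit vector, so the coefficient [y 0 r] is the entry of [u *m A] in column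
     [c]. *)
  have y0 r c : pivot M r c -> (tagnat.sig1 c < b)%N -> y 0 r = 0.
    move=> pv cb; have [M1 M0] := pivotsE _ _ pv.
    have := u0 (tagnat.sig1 c) cb; rewrite yM => /matrixP/(_ 0 (tagnat.sig2 c)).
    rewrite !mxE tagnat.sig2K (bigD1 r) //= M1 mulr1 big1 ?addr0 // => k kr.
    by rewrite M0 // mulr0.
  rewrite -uv yM -mul_submxrow mulmx_sum_row summx_sub // => r _.
  have [/existsP[c pc]|] := boolP [exists c, pivot M r c]; last first.
    move=> noc; suff -> : row r (submxrow M b) = 0 by rewrite scaler0 sub0mx.
    apply/rowP => j; rewrite !mxE; apply/eqP; apply: contraNT noc => nz.
    by have [l pl] := pivot_exists nz; apply/existsP; exists l.
  have [cb|bc|cb] := ltngtP (tagnat.sig1 c) b.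
  - by rewrite (y0 r c) // scale0r sub0mx.
  - suff -> : row r (submxrow M b) = 0 by rewrite scaler0 sub0mx.
    apply/rowP => j; rewrite !mxE; apply: before pc _.
    rewrite ltnNge; apply: contraL bc => /leq_sig1.
    by rewrite tagnat.Rank1K -leqNgt.
  - have rp : r \in pivot_rows M b.+1.
      by rewrite inE; apply/existsP; exists c; rewrite pc eqSS cb /=.
    rewrite scalemx_sub // -(enum_rankK_in rp rp) -row_rowsub.
    exact: row_sub.
apply/row_subP => r; rewrite row_rowsub; apply/lead_spaceP.
set s := enum_val r; have := enum_valP r; rewrite inE -/s.
case/existsP => c /andP[pc /eqP[cb]].
have sP : row s P *m A = row s M by rewrite MP row_mul.
exists (row s P) => [k kb|]; rewrite sP.
  apply/rowP => j; rewrite !mxE; apply: before pc _.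
  rewrite ltnNge; apply: contraL kb => /leq_sig1.
  by rewrite tagnat.Rank1K cb -leqNgt.
by apply/rowP => j; rewrite !mxE.
Qed.

Lemma E_lead_space (F : fieldType) m n (D : nat -> 'M[F]_m) (b : 'I_n) :
  (E n D b.+1 :=: lead_space (hankel D n) b)%MS.
Proof.
apply: eqmx_trans (eqmx_sym (lead_space_rref _ _)).
by rewrite /E /column_block /= valK; apply: eqmx_refl.
Qed.

(** * Ranks and nesting of the [E] blocks *)

Lemma rank_E0 (F : fieldType) m n (D : nat -> 'M[F]_m) : \rank (E n D 0) = 0%N.
Proof.
apply/eqP; rewrite -leqn0 (leq_trans (rank_leq_row _)) // leqn0.
rewrite cards_eq0; apply/set0Pn => -[r]; rewrite inE => /existsP[c].
by rewrite andbF.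
Qed.

Lemma rank_E (F : fieldType) m n (D : nat -> 'M[F]_m) k : (k < n)%N ->
  (\rank (E n D k.+1) + \rank (hankel D k))%N = \rank (hankel D k.+1).
Proof.
move=> kn; rewrite (E_lead_space D (Ordinal kn)).
exact: (rank_lead_space_hankel D (Ordinal kn)).
Qed.

Lemma E_subS (F : fieldType) m n (D : nat -> 'M[F]_m) k : (k < n)%N ->
  (E n D k <= E n D k.+1)%MS.
Proof.
case: k => [|k] kn.
  have /eqP := rank_E0 n D; rewrite mxrank_eq0 => /eqP ->; exact: sub0mx.
rewrite (E_lead_space D (Ordinal (ltnW kn))) (E_lead_space D (Ordinal kn)).
exact: lead_space_hankelS.
Qed.

Lemma E_sub (F : fieldType) m n (D : nat -> 'M[F]_m) k l :
  (k <= l)%N -> (l <= n)%N -> (E n D k <= E n D l)%MS.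
Proof.
elim: l => [|l IH]; first by rewrite leqn0 => /eqP ->.
rewrite leq_eqVlt => /predU1P[-> //|kl] ln.
exact: submx_trans (IH kl (ltnW ln)) (E_subS _ ln).
Qed.

Lemma rank_hankel0 (F : fieldType) m (D : nat -> 'M[F]_m) : \rank (hankel D 0) = 0%N.
Proof. by apply/eqP; rewrite -leqn0 (leq_trans (rank_leq_row _)) // big_ord0. Qed.

(** The first two values of [k] are separate because [d'] and [d''] have special first terms; they
    fit the formula as [hankel D 0] and [E n D 0] have rank 0. *)
Lemma d''_E (F : fieldType) m n (D : nat -> 'M[F]_m) k : (k < n)%N ->
  d'' D k.+1 = (\rank (E n D k.+1))%:Z - (\rank (E n D k))%:Z.
Proof.
move=> kn; rewrite /d'' /d' /d; case: k kn => [|[|k]] kn /=.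
- by rewrite rank_E0 subr0 -(rank_E D kn) rank_hankel0 addn0.
- rewrite -(rank_E D kn) -(rank_E D (ltnW kn)) rank_hankel0 addn0.
  by rewrite PoszD addrK.
- rewrite -(rank_E D kn) -(rank_E D (ltnW kn)).
  by rewrite PoszD addrK PoszD addrK.
Qed.

(** * Block triangular products with prescribed diagonal *)

Lemma block_upper_with_diagP (F : fieldType) i m (f : 'I_i -> nat)
    (B : forall j : 'I_i, 'M[F]_(f j, m))
    (X : 'M[F]_(\sum_j f j, \sum_(k < i) m)) (z : 'rV[F]_(\sum_j f j)) (j : 'I_i) :
  block_upper_with_diag B X ->
  (forall k : 'I_i, (k < j)%N -> submxrow z k = 0) ->
  (forall k : 'I_i, (k < j)%N -> submxrow (z *m X) k = 0) /\
  submxrow (z *m X) j = submxrow z j *m B j.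
Proof.
case=> Xd Xl z0.
have zX k : submxrow (z *m X) k = \sum_l submxrow z l *m submxblock X l k.
  rewrite -mul_submxrow -[in LHS](submxrowK z) -(submxcolK (submxrow X k)).
  by rewrite mul_mxrow_mxcol; apply: eq_bigr => l _; rewrite submxblockEh.
(* Terms with [l < j] vanish through [z], those with [l > j] through the zero blocks of [X]. *)
split=> [k kj|]; rewrite zX.
  rewrite big1 // => l _; have [lj|jl] := ltnP l j; first by rewrite z0 // mul0mx.
  by rewrite Xl ?mulmx0 // (leq_trans kj).
rewrite (bigD1 j) //= Xd big1 ?addr0 // => l; rewrite neq_ltn => /orP[lj|jl].
  by rewrite z0 // mul0mx.
by rewrite Xl ?mulmx0.
Qed.

Section BlockTriangular.
Variables (F : fieldType) (m n i : nat) (D : nat -> 'M[F]_m).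
Hypothesis i_le_n : (i.+1 <= n)%N.
Variables (f : 'I_i.+1 -> nat) (B : forall j : 'I_i.+1, 'M[F]_(f j, m)).
Hypothesis rankB : forall j, \rank (B j) = f j.
Hypothesis imB : forall (j : 'I_i.+1) (v : 'rV[F]_m),
  (v <= B j)%MS -> v != 0 -> (v <= E n D j.+1)%MS /\ ~~ (v <= E n D j)%MS.

Let lt_n (j : 'I_i.+1) : (j < n)%N.
Proof. exact: leq_trans (ltn_ord j) i_le_n. Qed.

Lemma diag_block_sub_E (j : 'I_i.+1) : (B j <= E n D j.+1)%MS.
Proof.
apply/rV_subP => v vB; have [->|v0] := eqVneq v 0; first exact: sub0mx.
by case: (imB vB v0).
Qed.

Lemma E_cap_diag_block (j : 'I_i.+1) : (E n D j :&: B j)%MS = 0.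
Proof.
apply/eqP/rowV0P => v; rewrite sub_capmx => /andP[vE vB].
by apply/eqP; apply: contraLR vE => /(imB vB)[].
Qed.

Lemma block_upper_exists :
  exists Q : 'M[F]_(\sum_j f j, \sum_(k < i.+1) m),
    block_upper_with_diag B (Q *m hankel D i.+1).
Proof.
(* The row blocks of [Q] are independent of each other; the boolean form lets [xchoose] pick them
   all. *)
have rowQ (j : 'I_i.+1) : exists Q : 'M[F]_(f j, \sum_(k < i.+1) m),
    (submxrow (Q *m hankel D i.+1) j == B j) &&
    [forall k : 'I_i.+1, (k < j)%N ==> (submxrow (Q *m hankel D i.+1) k == 0)].
  have := diag_block_sub_E j; rewrite (E_lead_space D (Ordinal (lt_n j))).
  rewrite (@lead_space_hankel _ _ D _ _ _ j) // => /lead_spaceP[Q Q0 Qj].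
  exists Q; rewrite Qj eqxx; apply/forallP => k; apply/implyP => kj.
  by rewrite Q0.
exists (\mxcol_j xchoose (rowQ j)); split=> [j|j k kj];
  rewrite submxblockEv -submxcol_mul mxcolK; case/andP: (xchooseP (rowQ j)).
  by move/eqP.
by move=> _ /forallP/(_ k)/implyP/(_ kj)/eqP.
Qed.

Lemma mxcol_full : (forall j : 'I_i.+1, (f j)%:Z = d'' D j.+1) ->
  (\mxcol_j B j == E n D i.+1)%MS.
Proof.
move=> fE; apply/andP; split.
  rewrite eqmx_col; apply/sumsmx_subP => j _; rewrite genmxE.
  by apply: submx_trans (diag_block_sub_E j) (E_sub _ _ _).
suff Esub k : (k <= i.+1)%N -> (E n D k <= \mxcol_j B j)%MS by exact: Esub.
elim: k => [_|k IH ki].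
  by have /eqP := rank_E0 n D; rewrite mxrank_eq0 => /eqP ->; apply: sub0mx.
pose j := Ordinal ki.
have sub : (E n D k + B j <= E n D k.+1)%MS.
  by rewrite addsmx_sub (E_subS _ (lt_n j)) (diag_block_sub_E j).
(* By its maximal size, [B j] is a complement of [E n D k] in [E n D k.+1]. *)
have rk : \rank (E n D k + B j)%MS = \rank (E n D k.+1).
  rewrite (mxrank_disjoint_sum (E_cap_diag_block j)) rankB.
  by have := fE j; rewrite (d''_E D (lt_n j)) /=; lia.
have [_] := mxrank_leqif_sup sub; rewrite rk eqxx => /esym Esub.
apply: submx_trans Esub _; rewrite addsmx_sub IH ?(ltnW ki) //=.
rewrite eqmx_col (sumsmx_sup j) //.
by rewrite genmxE.
Qed.

Lemma row_free_last (Q : 'M[F]_(\sum_j f j, \sum_(k < i.+1) m)) :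
  block_upper_with_diag B (Q *m hankel D i.+1) ->
  row_free (submxrow Q ord_max).
Proof.
move=> upQ; rewrite -kermx_eq0; apply/rowV0P => z /sub_kermxP zQ.
have [y ey] := rev_blocks (z *m Q).
(* Blocks of [y] are read from the right, so [y 0] is the last block of [z *m Q]. *)
have y0 : y 0%N = 0.
  by move: zQ; rewrite mul_submxrow ey mxrowK /= subSS subnn.
have convS k : conv D y k.+1 = conv D (fun a => y a.+1) k.
  by rewrite /conv big_ord_recl y0 mul0mx add0r.
suff z0 k (j : 'I_i.+1) : (j < k)%N -> submxrow z j = 0.
  by apply/mxrowP => j; rewrite (z0 j.+1) // submxrow0.
elim: k j => // k IH j; rewrite ltnS => jk.
have [] := block_upper_with_diagP (j := j) upQ (z := z).
  by move=> l lj; apply: IH; apply: leq_trans lj jk.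
rewrite mulmxA ey mul_hankel => low diag.
apply/eqP; rewrite -(mulmx_free_eq0 _ (B := B j)); last by rewrite /row_free rankB.
apply: contraT => nz; have [_ /negP[]] := imB (submxMl _ _) nz.
(* The first block has no room for an advance, but there the convolution is just [y 0 *m D 1], which
   is 0. *)
rewrite -diag; case: j jk low diag nz => -[|j] /= ji _ low diag nz.
  by rewrite /conv big_ord1 y0 mul0mx sub0mx.
have jn : (j < n)%N := leq_trans (ltnW ji) i_le_n.
rewrite (E_lead_space D (Ordinal jn)); apply/lead_space_hankelP => /=.
(* Advancing [y] by one block puts the leading block of the product in [E n D j.+1], which [imB]
   excludes for block [j.+1]. *)
exists (fun a => y a.+1) => [k' kj|]; rewrite -convS //.
have := low (Ordinal (leq_trans (kj : (k'.+1 < j.+1)%N) (ltnW ji))).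
by rewrite mul_hankel; apply.
Qed.

End BlockTriangular.

(* The paper's i is i.+1 here, and its f_j, F_j are f j, F j with j counted
   from 0. *)
Theorem lemma6 (R : realType) (n m : nat) (n_ge1 : (1 <= n)%N) (m_ge1 : (1 <= m)%N)
    (D : nat -> 'M[R]_m) (i : nat) (i_le_n : (i.+1 <= n)%N)
    (f : 'I_i.+1 -> nat) (F : forall j : 'I_i.+1, 'M[R]_(f j, m))
    (f_le : forall j : 'I_i.+1, (f j)%:Z <= d'' D j.+1)
    (rankF : forall j : 'I_i.+1, \rank (F j) = f j)
    (imF : forall (j : 'I_i.+1) (v : 'rV[R]_m),
       (v <= F j)%MS -> v != 0 -> (v <= E n D j.+1)%MS /\ ~~ (v <= E n D j)%MS) :
  [/\ exists Q : 'M[R]_(\sum_j f j, \sum_(k < i.+1) m),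
        block_upper_with_diag F (Q *m hankel D i.+1),
      (forall j : 'I_i.+1, (f j)%:Z = d'' D j.+1) ->
        (\mxcol_j F j == E n D i.+1)%MS
    & forall Q : 'M[R]_(\sum_j f j, \sum_(k < i.+1) m),
        block_upper_with_diag F (Q *m hankel D i.+1) ->
        row_free (submxrow Q ord_max)].
Proof.
have Q_ex := block_upper_exists i_le_n imF.
have F_full := mxcol_full i_le_n rankF imF.
have Q_free := row_free_last i_le_n rankF imF.
by split.
Qed.
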